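(* Let $\rho_\pm>0$, $u_\pm,\beta\in\mathbb{R}$ and $0<\alpha<1$ be given constants. As the perturbation parameter $A>0$ tends to $0$, the Riemann solutions (described in the context) of the approximated nonhomogeneous system $$\rho_t+(\rho u)_x=0,\qquad \Big(\rho\big(u-\tfrac{A}{\rho^{\alpha}}\big)\Big)_t+\Big(\rho u\big(u-\tfrac{A}{\rho^{\alpha}}\big)\Big)_x=\beta\rho$$ with initial data $(\rho,u)(x,0)=(\rho_-,u_-)$ for $x<0$ and $(\rho_+,u_+)$ for $x>0$ tend to the three kinds of Riemann solutions (described in the context) of the nonhomogeneous pressureless Euler equations with the same source term $$\rho_t+(\rho u)_x=0,\qquad (\rho u)_t+(\rho u^2)_x=\beta\rho$$ and the same initial data, which include a delta shock wave and a vacuum state. That is to say, the Riemann solutions to the transportation (pressureless Euler) equations with Coulomb-like friction are stable under this kind of flux perturbation.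
   Context: No topology is specified for the convergence ''tend to''. The limits as $A\to0$ are taken in the explicit solutions below, according to the three cases $u_-<u_+$ (the densities in the rarefaction wave and in the intermediate state tend to $0$, giving the vacuum), $u_-=u_+$ (the solutions coincide), and $u_->u_+$ (for $A$ small the solution is a delta shock wave, whose position $x(t)$, weight $w(t)$ and speed $u_\delta(t)$ converge to those of the limiting delta shock wave). Delta shock waves. For a smooth curve $S=\{(x(s),t(s)):a\le s\le b\}$ the weighted measure $w\,\delta_S$ is defined by $\langle w(s)\delta_S,\psi\rangle=\int_a^b w(s)\psi(x(s),t(s))\sqrt{x'(s)^2+t'(s)^2}\,ds$ for $\psi\in C_0^\infty(\mathbb{R}\times\mathbb{R}_+)$. A delta shock wave has the form $$(\rho,u)(x,t)=\begin{cases}(\rho_-,u_-+\beta t),&x<x(t),\\ (w(t)\delta(x-x(t)),u_\delta(t)),&x=x(t),\\ (\rho_+,u_++\beta t),&x>x(t),\end{cases}$$ where $\rho$ contains a weighted $\delta$-measure of weight $w(t)$ supported on the curve $x=x(t)$, $u_\delta(t)$ is the value assigned to $u$ on this curve, and $x'(t)=u_\delta(t)$. Riemann solutions of the pressureless system: (i) $u_-<u_+$: $(\rho_-,u_-+\beta t)$ for $x<u_-t+\frac12\beta t^2$; vacuum ($\rho=0$) for $u_-t+\frac12\beta t^2<x<u_+t+\frac12\beta t^2$; $(\rho_+,u_++\beta t)$ for $x>u_+t+\frac12\beta t^2$. (ii) $u_-=u_+$: a contact discontinuity, $(\rho_-,u_-+\beta t)$ for $x<u_-t+\frac12\beta t^2$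 and $(\rho_+,u_++\beta t)$ for $x>u_+t+\frac12\beta t^2$. (iii) $u_->u_+$: the delta shock wave with $\sigma_0=\frac{\sqrt{\rho_-}u_-+\sqrt{\rho_+}u_+}{\sqrt{\rho_-}+\sqrt{\rho_+}}$, $u_\delta(t)=\sigma_0+\beta t$, $x(t)=\sigma_0t+\frac12\beta t^2$, $w(t)=\sqrt{\rho_-\rho_+}\,(u_--u_+)t$. Riemann solutions of the approximated system. Put $w_-=u_--\frac{A}{\rho_-^\alpha}$, $x_2(t)=u_+t+\frac12\beta t^2$ and, when $u_+>w_-$, $v_*=u_+$, $\rho_*=\Big(\frac{A}{u_+-u_-+A/\rho_-^\alpha}\Big)^{1/\alpha}$. (a) $u_+>u_-$: a 1-rarefaction wave followed by a contact discontinuity: $(\rho_-,u_-+\beta t)$ to the left of the rarefaction wave; $(\rho_1,v_1+\beta t)$ inside it; $(\rho_*,v_*+\beta t)$ between the rarefaction wave and $x=x_2(t)$; $(\rho_+,u_++\beta t)$ for $x>x_2(t)$. The rarefaction wave issues from the origin and joins $(\rho_-,u_-)$ to $(\rho_*,v_* )$; its states satisfy $v_1-\frac{A}{\rho_1^\alpha}=w_-$ and propagate along the characteristics $\frac{dx}{dt}=v_1+\beta t-\frac{A\alpha}{\rho_1^\alpha}$, this characteristic speed being at least its value at $(\rho_-,u_-)$. (b) $u_+=u_-$: $(\rho_-,u_-+\beta t)$ for $x<u_-t+\frac12\beta t^2$ and $(\rho_+,u_++\beta t)$ for $x>u_+t+\frac12\beta t^2$. (c) $u_--\frac{A}{\rho_-^\alpha}<u_+<u_-$: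 a shock wave followed by a contact discontinuity: with $x_1(t)=\frac{\rho_*v_*-\rho_-u_-}{\rho_*-\rho_-}t+\frac12\beta t^2$, the solution is $(\rho_-,u_-+\beta t)$ for $x<x_1(t)$; $(\rho_*,v_*+\beta t)$ for $x_1(t)<x<x_2(t)$; $(\rho_+,u_++\beta t)$ for $x>x_2(t)$. (d) $u_+\le u_--\frac{A}{\rho_-^\alpha}$: the delta shock wave with $u_\delta(t)=v_\delta+\beta t$, $x(t)=v_\delta t+\frac12\beta t^2$, $w(t)=w_0t$, where for $\rho_+\ne\rho_-$ $$w_0=\sqrt{\rho_+\rho_-(u_+-u_-)\Big((u_+-u_-)-\big(\tfrac{A}{\rho_+^\alpha}-\tfrac{A}{\rho_-^\alpha}\big)\Big)+\tfrac14\Big(\tfrac{A}{\rho_+^{\alpha-1}}-\tfrac{A}{\rho_-^{\alpha-1}}\Big)^2}-\tfrac12\Big(\tfrac{A}{\rho_+^{\alpha-1}}-\tfrac{A}{\rho_-^{\alpha-1}}\Big),\quad v_\delta=\frac{\rho_+u_+-\rho_-u_-+w_0}{\rho_+-\rho_-},$$ and for $\rho_+=\rho_-$, $w_0=\rho_-u_--\rho_+u_+$ and $v_\delta=\frac12\big(u_++u_--\frac{A}{\rho_-^\alpha}\big)$. *)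

(* Defs.v *)
From HB Require Import structures.
From mathcomp Require Import all_boot all_order all_algebra.
From mathcomp Require Import all_classical all_reals all_analysis.
From mathcomp Require Import measurable_realfun ring lra.
Set Implicit Arguments.
Unset Strict Implicit.
Unset Printing Implicit Defensive.
Import Order.TTheory GRing.Theory Num.Theory.
Import numFieldNormedType.Exports.
Local Open Scope classical_set_scope.
Local Open Scope ring_scope.

(* The singular part of a delta shock wave: the curve x = position t, the weight
   of the delta measure it carries, and the value assigned to u on it. *)
Record delta_shock (R : realType) := DeltaShock {
  position : R -> R;
  weight : R -> R;
  delta_speed : R -> R }.

(* A wave on the half-plane t >= 0, as functions rho x t and vel x t.  The full
   density is the measure with Lebesgue density rho, plus the weighted delta
   measure described by delta if there is one. *)
Record wave (R : realType) := Wave {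
  rho : R -> R -> R;
  vel : R -> R -> R;
  delta : option (delta_shock R);
  measurable_rho : measurable_fun setT (fun p : R * R => rho p.1 p.2) }.

Section Riemann.
Context {R : realType}.
Implicit Types (s : wave R) (rhom um rhop up alpha beta A : R).

(* The curve x(t) with x(0) = 0 and x'(t) = c + beta t. *)
Definition ray beta (c t : R) : R := c * t + 2^-1 * beta * t ^+ 2.

Definition has_state s beta (r v x t : R) : Prop :=
  rho s x t = r /\ vel s x t = v + beta * t.

(* In all the descriptions below, the time t = 0 is included for the outer
   states: this is the initial condition. *)

(* The slopes c1 and c2 are equal when there is only one front. *)
Definition outer_states s rhom um rhop up beta (c1 c2 : R) : Prop :=
  forall x t, 0 <= t ->
    (x < ray beta c1 t -> has_state s beta rhom um x t) /\
    (ray beta c2 t < x -> has_state s beta rhop up x t).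

Definition contact_wave s rhom um rhop up beta : Prop :=
  delta s = None /\ outer_states s rhom um rhop up beta um up.

Definition delta_shock_wave s rhom um rhop up beta (v0 w0 : R) : Prop :=
  outer_states s rhom um rhop up beta v0 v0 /\
  exists2 d, delta s = Some d & forall t, 0 <= t ->
    [/\ position d t = ray beta v0 t,
        weight d t = w0 * t,
        delta_speed d t = v0 + beta * t &
        vel s (position d t) t = delta_speed d t].

(** Pressureless system *)

(* The velocity is left free in the vacuum. *)
Definition vacuum_wave s rhom um rhop up beta : Prop :=
  [/\ delta s = None,
      outer_states s rhom um rhop up beta um up &
      forall x t, 0 <= t -> ray beta um t < x -> x < ray beta up t ->
        rho s x t = 0].

Definition sigma0 rhom um rhop up : R :=
  (Num.sqrt rhom * um + Num.sqrt rhop * up) / (Num.sqrt rhom + Num.sqrt rhop).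

Definition pressureless_solution rhom um rhop up beta s : Prop :=
  [/\ um < up -> vacuum_wave s rhom um rhop up beta,
      um = up -> contact_wave s rhom um rhop up beta &
      up < um -> delta_shock_wave s rhom um rhop up beta
                   (sigma0 rhom um rhop up)
                   (Num.sqrt (rhom * rhop) * (um - up))].

(* The curves on which the Riemann solution of the pressureless system jumps. *)
Definition pressureless_fronts rhom um rhop up beta : set (R * R) :=
  [set p | if up < um then p.1 = ray beta (sigma0 rhom um rhop up) p.2
           else p.1 = ray beta um p.2 \/ p.1 = ray beta up p.2].

(** Approximated system *)

Definition wminus rhom um alpha A : R := um - A / rhom `^ alpha.

Definition rho_star rhom um up alpha A : R :=
  (A / (up - um + A / rhom `^ alpha)) `^ alpha^-1.

Definition lambda1 alpha A (r v : R) : R := v - A * alpha / r `^ alpha.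

(* A 1-characteristic issuing from the origin and carrying the state (r, v). *)
Definition characteristic1 alpha beta A (r v : R) (X : R -> R) : Prop :=
  X t @[t --> (0:R)^'+] --> (0:R) /\
  forall t : R, 0 < t -> is_derive t (1:R) X (lambda1 alpha A r v + beta * t).

(* The rarefaction wave fills the sector bounded by the characteristics that
   carry the two states it joins, (rhom, um) and (rho_star, up). *)
Definition rarefaction1 s rhom um up alpha beta A : Prop :=
  forall x t, 0 < t ->
    ray beta (lambda1 alpha A rhom um) t <= x ->
    x <= ray beta (lambda1 alpha A (rho_star rhom um up alpha A) up) t ->
    exists r v X,
      [/\ 0 < r,
          v - A / r `^ alpha = wminus rhom um alpha A,
          lambda1 alpha A rhom um <= lambda1 alpha A r v,
          characteristic1 alpha beta A r v X /\ X t = x &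
          forall t', 0 < t' -> has_state s beta r v (X t') t'].

Definition rarefaction_contact_wave s rhom um rhop up alpha beta A : Prop :=
  let rs := rho_star rhom um up alpha A in
  [/\ delta s = None,
      outer_states s rhom um rhop up beta (lambda1 alpha A rhom um) up,
      rarefaction1 s rhom um up alpha beta A &
      forall x t, 0 <= t ->
        ray beta (lambda1 alpha A rs up) t < x -> x < ray beta up t ->
        has_state s beta rs up x t].

Definition shock_contact_wave s rhom um rhop up alpha beta A : Prop :=
  let rs := rho_star rhom um up alpha A in
  let c1 := (rs * up - rhom * um) / (rs - rhom) in
  [/\ delta s = None,
      outer_states s rhom um rhop up beta c1 up &
      forall x t, 0 <= t -> ray beta c1 t < x -> x < ray beta up t ->
        has_state s beta rs up x t].

Definition w0 rhom um rhop up alpha A : R :=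
  if rhop == rhom then rhom * um - rhop * up else
  let a := A / rhop `^ alpha - A / rhom `^ alpha in
  let b := A / rhop `^ (alpha - 1) - A / rhom `^ (alpha - 1) in
  Num.sqrt (rhop * rhom * (up - um) * ((up - um) - a) + 4^-1 * b ^+ 2)
  - 2^-1 * b.

Definition v_delta rhom um rhop up alpha A : R :=
  if rhop == rhom then 2^-1 * (up + um - A / rhom `^ alpha)
  else (rhop * up - rhom * um + w0 rhom um rhop up alpha A) / (rhop - rhom).

Definition approx_solution rhom um rhop up alpha beta A s : Prop :=
  [/\ um < up -> rarefaction_contact_wave s rhom um rhop up alpha beta A,
      um = up -> contact_wave s rhom um rhop up beta,
      wminus rhom um alpha A < up < um ->
        shock_contact_wave s rhom um rhop up alpha beta A &
      up <= wminus rhom um alpha A ->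
        delta_shock_wave s rhom um rhop up beta
          (v_delta rhom um rhop up alpha A) (w0 rhom um rhop up alpha A)].

(** Convergence *)

(* The weighted measure w delta_S on the curve S = {(x(s), tau(s)) : s in I}. *)
Definition weighted_delta (I : set R) (w x tau : R -> R) (psi : R * R -> R) : R :=
  \int[lebesgue_measure]_(s in I)
    (w s * psi (x s, tau s) * Num.sqrt (derive1 x s ^+ 2 + derive1 tau s ^+ 2)).

(* The density of s, as a measure on the half-plane t > 0, applied to psi. *)
Definition density_pairing s (psi : R * R -> R) : R :=
  \int[(lebesgue_measure \x lebesgue_measure)%E]_(p in [set p : R * R | 0 < p.2])
    (rho s p.1 p.2 * psi p)
  + if delta s is Some d
    then weighted_delta `]0, +oo[ (weight d) (position d) id psi else 0.

(* Every C^infty function with compact support in the closed or in the open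
   half-plane is the restriction of a function of this kind. *)
Definition test_function (psi : R * R -> R) : Prop :=
  continuous psi /\ compact (closure [set p | psi p != 0]).

(* The solutions s A tend to s0 as A -> 0+: pointwise off the fronts E of s0
   (the velocity where s0 is not a vacuum), the density as a measure, and, for
   a delta shock, its position, weight and speed. *)
Definition tends_to (E : set (R * R)) (s : R -> wave R) (s0 : wave R) : Prop :=
  [/\ forall x t, 0 < t -> ~ E (x, t) ->
        rho (s A) x t @[A --> (0:R)^'+] --> rho s0 x t,
      forall x t, 0 < t -> ~ E (x, t) -> rho s0 x t != 0 ->
        vel (s A) x t @[A --> (0:R)^'+] --> vel s0 x t,
      forall psi, test_function psi ->
        density_pairing (s A) psi @[A --> (0:R)^'+] --> density_pairing s0 psi &
      match delta s0 with
      | None => \forall A \near (0:R)^'+, delta (s A) = None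
      | Some d0 => exists d : R -> delta_shock R,
          (\forall A \near (0:R)^'+, delta (s A) = Some (d A)) /\
          forall t, 0 < t ->
            [/\ position (d A) t @[A --> (0:R)^'+] --> position d0 t,
                weight (d A) t @[A --> (0:R)^'+] --> weight d0 t &
                delta_speed (d A) t @[A --> (0:R)^'+] --> delta_speed d0 t]
      end].

End Riemann.

(* Solutions as described above exist: pressureless_solution_exists and
   approx_solution_exists. *)
Section Existence.
Context {R : realType}.
Implicit Types (rhom um rhop up alpha beta A : R).

Definition wave3 (rhom um rhop up beta c1 c2 : R) (m n : R -> R -> R) (x t : R) :=
  (if x < ray beta c1 t then rhom else if ray beta c2 t < x then rhop else m x t,
   if x < ray beta c1 t then um + beta * t
   else if ray beta c2 t < x then up + beta * t else n x t).

Lemma measurable_ray beta (c : R) :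
  measurable_fun setT (fun p : R * R => ray beta c p.2).
Proof.
rewrite /ray; apply: measurable_funD.
- by apply: measurable_funM => //; exact: measurable_snd.
- apply: measurable_funM => //.
  by apply: measurable_funX; exact: measurable_snd.
Qed.

Lemma measurable_wave3 rhom um rhop up beta (c1 c2 : R) m n :
  measurable_fun setT (fun p : R * R => m p.1 p.2) ->
  measurable_fun setT
    (fun p : R * R => (wave3 rhom um rhop up beta c1 c2 m n p.1 p.2).1).
Proof.
move=> measurable_mid; rewrite /wave3 /=.
apply: measurable_fun_ifT => //.
  by apply: measurable_fun_ltr; [exact: measurable_fst|exact: measurable_ray].
apply: measurable_fun_ifT => //.
by apply: measurable_fun_ltr; [exact: measurable_ray|exact: measurable_fst].
Qed.

Definition mkwave rhom um rhop up beta c1 c2 m n d measurable_mid : wave R :=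
  @Wave R (fun x t => (wave3 rhom um rhop up beta c1 c2 m n x t).1)
    (fun x t => (wave3 rhom um rhop up beta c1 c2 m n x t).2) d
    (@measurable_wave3 rhom um rhop up beta c1 c2 m n measurable_mid).

Lemma ler_ray beta (c1 c2 t : R) : c1 <= c2 -> 0 <= t -> ray beta c1 t <= ray beta c2 t.
Proof. by move=> c12 t0; rewrite /ray lerD2r ler_wpM2r. Qed.

Lemma mkwave_outer rhom um rhop up beta c1 c2 m n d measurable_mid : c1 <= c2 ->
  outer_states (@mkwave rhom um rhop up beta c1 c2 m n d measurable_mid) rhom um rhop up beta c1 c2.
Proof.
move=> c12 x t t0; have le12 := ler_ray beta c12 t0.
rewrite /has_state /= /wave3 /=; split=> [xl|lx]; first by rewrite xl.
by rewrite ltNge (ltW (le_lt_trans le12 lx)) lx.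
Qed.

Lemma mkwave_mid rhom um rhop up beta c1 c2 m n d measurable_mid (x t : R) :
  ray beta c1 t <= x -> x <= ray beta c2 t ->
  rho (@mkwave rhom um rhop up beta c1 c2 m n d measurable_mid) x t = m x t /\
  vel (@mkwave rhom um rhop up beta c1 c2 m n d measurable_mid) x t = n x t.
Proof. by move=> h1 h2; rewrite /= /wave3 /= !ltNge h1 h2. Qed.

Lemma measurable_cst2 (c : R) : measurable_fun setT (fun p : R * R => (fun _ _ : R => c) p.1 p.2).
Proof. exact: measurable_cst. Qed.

Lemma delta_shock_wave_ex rhom um rhop up beta (v w : R) :
  exists s, delta_shock_wave s rhom um rhop up beta v w.
Proof.
exists (@mkwave rhom um rhop up beta v v _ (fun _ t => v + beta * t)
  (Some (DeltaShock (ray beta v) ( *%R w) (fun t => v + beta * t))) (measurable_cst2 0)).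
split; first exact: mkwave_outer.
eexists; first by [].
move=> t t0; split => //.
by rewrite /= /wave3 /= !ltxx.
Qed.

Lemma contact_wave_ex rhom um rhop up beta : um <= up ->
  exists s, contact_wave s rhom um rhop up beta.
Proof.
move=> h; exists (@mkwave rhom um rhop up beta um up _ (fun _ t => 0) None (measurable_cst2 0)).
by split => //; exact: mkwave_outer.
Qed.

Lemma pressureless_solution_exists rhom um rhop up beta :
  exists s, pressureless_solution rhom um rhop up beta s.
Proof.
rewrite /pressureless_solution; have [h|h|->] := ltgtP um up.
- exists (@mkwave rhom um rhop up beta um up _ (fun _ t => 0) None (measurable_cst2 0)).
  split => // [_|e]; last by rewrite e ltxx in h.
  split => //; first by apply: mkwave_outer; exact: ltW.
  by move=> x t t0 /ltW h1 /ltW h2; case: (@mkwave_mid rhom um rhop up beta um up _ (fun _ _ => 0) None (measurable_cst2 0) _ _ h1 h2).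
- have [s hs] := delta_shock_wave_ex rhom um rhop up beta
     (sigma0 rhom um rhop up) (Num.sqrt (rhom * rhop) * (um - up)).
  by exists s; split => // e; rewrite e ltxx in h.
- have [s hs] := @contact_wave_ex rhom up rhop up beta (lexx _).
  by exists s.
Qed.

Section approx.
Variables (rhom um rhop up alpha beta A : R).
Hypotheses (rm0 : 0 < rhom) (a0 : 0 < alpha) (a1 : alpha < 1) (A0 : 0 < A).
Let wm := wminus rhom um alpha A.
Let rs := rho_star rhom um up alpha A.

Lemma wm_lt : wm < um.
Proof. by rewrite /wm /wminus ltrBlDr ltrDl divr_gt0// powR_gt0. Qed.

Lemma rs_def : wm < up -> 0 < rs /\ A / rs `^ alpha = up - wm.
Proof.
move=> h; have p0 : 0 < up - um + A / rhom `^ alpha by move: h; rewrite /wm/wminus; lra.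
split; first by rewrite /rs /rho_star powR_gt0// divr_gt0.
rewrite /rs /rho_star -powRrM mulVf ?gt_eqF// powRr1 ?ltW ?divr_gt0//.
rewrite invf_div mulrCA divff ?gt_eqF// mulr1 /wm/wminus; lra.
Qed.

Let c1 := lambda1 alpha A rhom um.
Let cs := lambda1 alpha A rs up.

(* In the fan, Y = v - A alpha / r^alpha - wm = (1 - alpha) A / r^alpha, which is
   solved for r by fr. *)
Let Y (x t : R) := x * t `^ (-1) - 2^-1 * beta * t - wm.
Let fr x t := (A * (1 - alpha)) `^ alpha^-1 * (Y x t) `^ (- alpha^-1).
Let fv x t := wm + A / fr x t `^ alpha + beta * t.
Let m x t := if x <= ray beta cs t then fr x t else rs.
Let n x t := if x <= ray beta cs t then fv x t else up + beta * t.

Lemma measurable_mid : measurable_fun setT (fun p : R * R => m p.1 p.2).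
Proof.
rewrite /m; apply: measurable_fun_ifT => //.
  by apply: measurable_fun_ler; [exact: measurable_fst|exact: measurable_ray].
rewrite /fr; apply: measurable_funM => //.
apply: (measurableT_comp (measurable_powR _)).
rewrite /Y; apply: measurable_funB => //; apply: measurable_funB.
  apply: measurable_funM; first exact: measurable_fst.
  by apply: (measurableT_comp (measurable_powR _)); exact: measurable_snd.
by apply: measurable_funM => //; exact: measurable_snd.
Qed.

Lemma raref_ex : um < up -> exists s, rarefaction_contact_wave s rhom um rhop up alpha beta A.
Proof.
move=> ltu.
have wu := lt_trans wm_lt ltu.
have [rs0 rsE] := rs_def wu.
have rm : A / rhom `^ alpha = um - wm by rewrite /wm /wminus; lra.
have c1E : c1 = wm + (1 - alpha) * (um - wm).
  by rewrite /c1 /lambda1 mulrAC rm; ring.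
have csE : cs = wm + (1 - alpha) * (up - wm).
  by rewrite /cs /lambda1 mulrAC rsE; ring.
have c12 : c1 <= cs by rewrite c1E csE; have := a1; move: ltu; nra.
have csu : cs <= up by rewrite csE; move: wu (a0); nra.
exists (@mkwave rhom um rhop up beta c1 up m n None measurable_mid).
split => //.
- apply: mkwave_outer; exact: le_trans csu.
- move=> x t t0; rewrite -/c1 -/rs -/cs => xl xr.
  pose xi := Y x t + wm.
  have xE : x = ray beta xi t.
    rewrite /xi /Y /ray powR_inv1 ?ltW//; field; exact: lt0r_neq0.
  have c1xi : c1 <= xi.
    by move: xl; rewrite xE /ray lerD2r ler_pM2r.
  have xics : xi <= cs.
    by move: xr; rewrite xE /ray lerD2r ler_pM2r.
  have y0 : 0 < xi - wm.
    rewrite subr_gt0; apply: lt_le_trans c1xi; rewrite c1E.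
    have := wm_lt; move: (a1); nra.
  pose r := (A * (1 - alpha)) `^ alpha^-1 * (xi - wm) `^ (- alpha^-1).
  have A10 : 0 < A * (1 - alpha) by rewrite mulr_gt0// subr_gt0.
  have r0 : 0 < r by rewrite mulr_gt0// powR_gt0.
  have rE : A / r `^ alpha = (xi - wm) / (1 - alpha).
    rewrite /r powRM ?powR_ge0// -!powRrM mulNr mulVf ?gt_eqF// powRr1 ?ltW//.
    rewrite powR_inv1 ?ltW//; field.
    by rewrite !lt0r_neq0//; move: a1; lra.
  have lE : lambda1 alpha A r (wm + A / r `^ alpha) = xi.
    rewrite /lambda1 (mulrAC A) rE; field; rewrite lt0r_neq0//; move: a1; lra.
  exists r, (wm + A / r `^ alpha), (ray beta xi); split => //.
  + by rewrite addrK.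
  + by rewrite lE.
  + split => //; split.
      suff : ray beta xi t @[t --> (0:R)] --> ray beta xi 0.
        rewrite {2}/ray mulr0 expr0n mulr0 addr0 => h.
        exact: cvg_at_right_filter h.
      rewrite /ray.
      by apply: cvgD; apply: cvgM; (try exact: cvg_cst) => //; apply: exprn_continuous.
    move=> t' _; rewrite lE /ray.
    have -> : (fun t => xi * t + 2^-1 * beta * t ^+ 2) =
      (xi \*: (id : R -> R)) + (2^-1 * beta) \*: ((id : R -> R) ^+ 2).
      by apply/funext => z /=; rewrite /GRing.scale/= .
    apply: is_derive_eq.
    by rewrite /GRing.scale /=; field.
  + move=> t' t'0.
    have l' : ray beta c1 t' <= ray beta xi t' by apply: ler_ray => //; exact: ltW.
    have r' : ray beta xi t' <= ray beta cs t' by apply: ler_ray => //; exact: ltW.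
    have r'' := le_trans r' (ler_ray beta csu (ltW t'0)).
    have [e1 e2] := @mkwave_mid rhom um rhop up beta c1 up m n None measurable_mid _ _ l' r''.
    rewrite /has_state e1 e2 /m /n r'.
    have YE : Y (ray beta xi t') t' = xi - wm.
      rewrite /Y /ray powR_inv1 ?ltW//; field; exact: lt0r_neq0.
    by rewrite /fv /fr YE.
- move=> x t t0; rewrite -/rs -/cs => h1 h2.
  have h0 := le_trans (ler_ray beta c12 t0) (ltW h1).
  have [e1 e2] := @mkwave_mid rhom um rhop up beta c1 up m n None measurable_mid _ _ h0 (ltW h2).
  by rewrite /has_state e1 e2 /m /n leNgt h1.
Qed.

Lemma approx_solution_exists : exists s, approx_solution rhom um rhop up alpha beta A s.
Proof.
rewrite /approx_solution; have wl := wm_lt; rewrite -/wm.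
have [h|h|e] := ltgtP um up.
- have [s hs] := raref_ex h; exists s; split => //.
  + by move=> e; rewrite e ltxx in h.
  + by rewrite andbF.
  + by move=> h'; move: (lt_trans wl h); rewrite ltNge h'.
- have [h'|h'] := leP up wm.
    have [s hs] := delta_shock_wave_ex rhom um rhop up beta
      (v_delta rhom um rhop up alpha A) (w0 rhom um rhop up alpha A).
    by exists s; split => // e; rewrite e ltxx in h.
  have [rs0 rsE] := rs_def h'.
  pose c := (rs * up - rhom * um) / (rs - rhom).
  have rm : A / rhom `^ alpha = um - wm by rewrite /wm /wminus; lra.
  have rsr : 0 < rs - rhom.
    rewrite subr_gt0 ltNge; apply/negP => hr.
    have : rs `^ alpha <= rhom `^ alpha.
      apply: ge0_ler_powR => //; rewrite ?nnegrE; exact: ltW.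
    have : rhom `^ alpha < rs `^ alpha.
      have h1 : A / rs `^ alpha < A / rhom `^ alpha by rewrite rsE rm; lra.
      rewrite (ltr_pM2l A0) in h1; rewrite ltf_pV2 ?posrE in h1 => //; exact: powR_gt0.
    by move=> h1 h2; have := lt_le_trans h1 h2; rewrite ltxx.
  have cu : c <= up by rewrite /c ler_pdivrMr//; move: rm0 h; nra.
  exists (@mkwave rhom um rhop up beta c up _ (fun _ t => up + beta * t) None (measurable_cst2 rs)).
  split => //; first by move=> e; rewrite e ltxx in h.
  move=> _; split => //; first exact: mkwave_outer.
  move=> x t t0; rewrite -/rs -/c => /ltW h1 /ltW h2.
  by have [e1 e2] := @mkwave_mid rhom um rhop up beta c up _ (fun _ t => up + beta * t) None (measurable_cst2 rs) _ _ h1 h2.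
- have [s hs] : exists s, contact_wave s rhom um rhop up beta.
    by apply: contact_wave_ex; rewrite e.
  exists s; split => //; first by rewrite andbF.
  by rewrite leNgt -e wl.
Qed.
End approx.
End Existence.

(* Main.v *)
Require Import Defs.
From HB Require Import structures.
From mathcomp Require Import all_boot all_order all_algebra.
From mathcomp Require Import all_classical all_reals all_analysis.
From mathcomp Require Import measurable_realfun ring lra.
Import Order.TTheory GRing.Theory Num.Theory.
Import numFieldNormedType.Exports.
Local Open Scope classical_set_scope.
Local Open Scope ring_scope.

(* The convergence of the densities as measures is dominated convergence: test
   functions have compact support, the densities stay below max(rhom, rhop) for
   small A off at most two rays, and rays are Lebesgue-null in the plane.  This
   leaves only pointwise limits.
   - um < up: on a state (r, v) of the fan, v - A / r^alpha = wminus and the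
     speed is c = wminus + (1 - alpha) A / r^alpha, so on the ray of speed
     c > um one has A / r^alpha >= c - um, which forces r -> 0 as A -> 0; the
     same bound holds for rho_star.
   - up < um: for small A the solution is a delta shock, and v_delta and w0 are
     continuous in A, their values at A = 0 being the limiting speed and weight. *)

(** * Dominated convergence for one-sided limits *)

(** A limit at [a^'+] can be tested on sequences, to which the sequential dominated convergence
    theorem applies. *)
Lemma cvg_Rintegral_at_right {d} {T : measurableType d} {R : realType}
    (mu : {measure set T -> \bar R}) {D : set T} {f : R -> T -> R}
    {f0 g : T -> R} (a : R) :
  measurable D ->
  (\forall A \near a^'+, measurable_fun D (f A)) -> measurable_fun D f0 ->
  mu.-integrable D (EFin \o g) ->
  (\forall A \near a^'+, {ae mu, forall x, D x -> `|f A x| <= g x}) ->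
  {ae mu, forall x, D x -> f A x @[A --> a^'+] --> f0 x} ->
  \int[mu]_(x in D) f A x @[A --> a^'+] --> \int[mu]_(x in D) f0 x.
Proof.
move=> mD mf mf0 ig fg ff.
apply/cvg_at_rightP => u [ua ucvg].
(* What holds near [a] holds along [u] only from some rank [N] on, so the sequence is shifted by
   [N]. *)
have [N _ HN] := ucvg _ (filterI mf fg : nbhs a^'+ _).
rewrite -(cvg_shiftn N); apply: fine_cvg.
have [|||||i0 _] := @dominated_convergence _ _ _ mu D mD
  (fun n => EFin \o f (u (n + N)%N)) (EFin \o f0) (EFin \o g).
- move=> n; apply/measurable_EFinP.
  by have [] := HN (n + N)%N (leq_addl _ _) (ua _).
- exact/measurable_EFinP.
- move: ff; apply: filterS => x h Dx; apply: cvg_EFin; first exact: nearW.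
  have /cvg_at_rightP := h Dx; apply; split=> [n|]; first exact: ua.
  by move: ucvg; rewrite -(cvg_shiftn N).
- exact: ig.
- apply: ae_foralln => n; have [_] := HN (n + N)%N (leq_addl _ _) (ua _).
  by apply: filterS => x h Dx; rewrite lee_fin; exact: h.
- rewrite /Rintegral fineK//; exact: integrable_fin_num.
Qed.

(** * Measurability and null sets in the plane *)

(** The product sigma-algebra is generated by rectangles, and an open set is the union of the
    countably many squares with rational centre and radius that it contains. *)
Lemma open_prod_measurable {R : realType} (U : set (R * R)) :
  open U -> measurable U.
Proof.
move=> oU.
pose B (a b r : rat) : set (R * R) :=
  ball (ratr a : R) (ratr r : R) `*` ball (ratr b : R) (ratr r : R).
have -> : U = \bigcup_a \bigcup_b \bigcup_r
    (if `[< B a b r `<=` U >] then B a b r else set0).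
  apply/seteqP; split=> [[x y] Uxy|p [a _ [b _ [r _]]]]; last first.
    by case: asboolP => // + Bp; exact.
  have [e /= e0 eU] : exists2 e : R, 0 < e & ball (x, y) e `<=` U.
    by move: oU; rewrite openE => /(_ _ Uxy) /nbhs_ballP[e /= e0 eU]; exists e.
  (* A square of radius [r] whose centre is within [r] of the point stays within [2 r < e] of it. *)
  have [r] : exists r : rat, (ratr r : R) \in `]0, e / 2[.
    by apply: rat_in_itvoo; rewrite divr_gt0.
  rewrite in_itv /= => /andP[r0 re].
  have [a] : exists r' : rat, (ratr r' : R) \in `]x - ratr r, x + ratr r[.
    by apply: rat_in_itvoo; lra.
  have [b] : exists r' : rat, (ratr r' : R) \in `]y - ratr r, y + ratr r[.
    by apply: rat_in_itvoo; lra.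
  rewrite !in_itv /= => hb ha.
  exists a => //; exists b => //; exists r => //.
  rewrite ifT.
    by split; rewrite /= /ball /= ltr_distl; lra.
  apply/asboolP => -[x' y'] [/=]; rewrite /ball /= !ltr_distl => h1 h2.
  by apply: eU; split; rewrite /= /ball /= ltr_distl; lra.
apply: bigcupT_measurable_rat => a; apply: bigcupT_measurable_rat => b.
apply: bigcupT_measurable_rat => r; case: ifP => // _.
by apply: measurableX; exact: measurable_ball.
Qed.

Lemma continuous_prod_measurable_fun {R : realType} (f : R * R -> R) :
  continuous f -> measurable_fun setT f.
Proof.
move=> /continuousP cf; apply: (measurability _ (RGenOpens.measurableE R)).
move=> _ [_ [a [b ->] <-]]; rewrite setTI; apply: open_prod_measurable.
by apply: cf; exact: interval_open.
Qed.

Lemma measurable_on_ray {R : realType} (beta c : R) :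
  measurable [set p : R * R | p.1 = ray beta c p.2].
Proof.
rewrite (_ : mkset _ = (fun p : R * R => p.1 - ray beta c p.2) @^-1` [set 0]).
  rewrite -[X in measurable X]setTI.
  apply: (measurable_funB measurable_fst (measurable_ray beta c)) => //.
by apply/seteqP; split=> p /=; [move=> ->; rewrite subrr|move/eqP; rewrite subr_eq0 => /eqP].
Qed.

(** At a fixed time the ray is a single point, so the measure is computed by integrating sections
    over [t]. This is the order of integration of [\x^], which agrees with [\x] because both have
    the same values on rectangles. *)
Lemma ray_null {R : realType} (beta c : R) :
  (lebesgue_measure \x lebesgue_measure)%E
    [set p : R * R | p.1 = ray beta c p.2] = 0%E.
Proof.
have mE := measurable_on_ray beta c.
transitivity ((lebesgue_measure \x^ lebesgue_measure)%E
    [set p : R * R | p.1 = ray beta c p.2]).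
  pose l : {sigma_finite_measure set (measurableTypeR R) -> \bar R} := lebesgue_measure.
  apply: (@product_measure_unique _ _ _ _ _ l l (l \x^ l)%E) => // A B mA mB.
  exact: product_measure2E.
apply: integral0_eq => t _ /=.
rewrite (_ : ysection _ _ = [set ray beta c t]) ?lebesgue_measure_set1//.
by apply/seteqP; split=> x; rewrite /ysection/= ?inE.
Qed.

Lemma off_rays_ae {R : realType} (beta c1 c2 : R) (P : R * R -> Prop) :
  (forall x t, x != ray beta c1 t -> x != ray beta c2 t -> P (x, t)) ->
  {ae (lebesgue_measure \x lebesgue_measure)%E, forall p : R * R, P p}.
Proof.
move=> offP; exists ([set p : R * R | p.1 = ray beta c1 p.2] `|`
                     [set p : R * R | p.1 = ray beta c2 p.2]); split.
- by apply: measurableU; exact: measurable_on_ray.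
- apply: null_set_setU; do ?[exact: measurable_on_ray|exact: ray_null].
- move=> [x t] /= nP; apply: contrapT => /not_orP[/eqP n1 /eqP n2].
  by apply: nP; exact: offP.
Qed.

(** All dominating functions below have this form: a constant on a bounded square or segment
    containing the support of the integrand. *)
Lemma integrable_scaled_indic {d} {T : measurableType d} {R : realType}
    (mu : {measure set T -> \bar R}) (D E : set T) (k : R) :
  measurable D -> measurable E -> (mu E < +oo)%E ->
  mu.-integrable D (EFin \o (fun x => k * \1_E x)).
Proof.
move=> mD mE Efin.
apply: (eq_integrable mD (fun x => k%:E * (\1_E x)%:E)%E) => //.
apply: integrableZl => //; apply/integrableP; split.
  by apply/measurable_EFinP; exact: measurable_indic.
under eq_integral do rewrite gee0_abs ?lee_fin//.
rewrite integral_indic//; apply: le_lt_trans Efin.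
by apply: le_measure; rewrite ?inE//; exact: measurableI.
Qed.

(** * Test functions and convergence of the density integrals *)

Lemma test_function_bounded {R : realType} {psi : R * R -> R} :
  test_function psi -> exists M B : R,
    [/\ 0 <= M, 0 <= B, forall p, psi p != 0 -> `|p.1| <= M /\ `|p.2| <= M &
        forall p, `|psi p| <= B].
Proof.
move=> [cpsi Kc].
have [M [_ HM]] := compact_bounded Kc.
have [B [_ HB]] := compact_bounded
  (continuous_compact (continuous_subspaceT cpsi) Kc).
(* [compact_bounded] gives a bound for every real strictly above [M]; this one is moreover
   nonnegative. *)
exists (`|M| + 1), (`|B| + 1); split=> [||p p0|p]; rewrite ?addr_ge0//.
- have : `|p| <= `|M| + 1.
    apply: (HM (`|M| + 1)); first by rewrite ltr_pwDr// ler_norm.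
    exact: subset_closure.
  by rewrite prod_normE ge_max => /andP[].
- have [->|p0] := eqVneq (psi p) 0; first by rewrite normr0 addr_ge0.
  apply: (HB (`|B| + 1)); first by rewrite ltr_pwDr// ler_norm.
  by exists p => //; exact: subset_closure.
Qed.

Lemma lebesgue_segment_lty {R : realType} (M : R) :
  (lebesgue_measure (`[(- M)%R, M]%classic : set R) < +oo)%E.
Proof.
by rewrite lebesgue_measure_itv/=; case: ifP => _; rewrite ?ltry// -EFinB ltry.
Qed.

Lemma lebesgue_square_lty {R : realType} (M : R) :
  ((lebesgue_measure \x lebesgue_measure)
     (`[(- M)%R, M]%classic `*` `[(- M)%R, M]%classic) < +oo)%E.
Proof.
have fin := lebesgue_segment_lty M.
rewrite product_measure1E//; apply: lte_mul_pinfty => //.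
by rewrite ge0_fin_numE.
Qed.

(** The integrand is dominated by [C * B] on the square [[-M, M]^2], outside which [psi] vanishes.
    The exceptional rays of the bound may move with [A], since domination is asked almost everywhere
    for each [A] separately. *)
Lemma density_integral_cvg {R : realType} (beta C : R) (s : R -> wave R)
    (s0 : wave R) (c1 c2 : R -> R) (e1 e2 : R) (psi : R * R -> R) :
  (\forall A \near (0:R)^'+, forall x t, 0 < t -> x != ray beta (c1 A) t ->
     x != ray beta (c2 A) t -> `|rho (s A) x t| <= C) ->
  (forall x t, 0 < t -> x != ray beta e1 t -> x != ray beta e2 t ->
     rho (s A) x t @[A --> (0:R)^'+] --> rho s0 x t) ->
  test_function psi ->
  \int[(lebesgue_measure \x lebesgue_measure)%E]_(p in [set p : R * R | 0 < p.2])
    (rho (s A) p.1 p.2 * psi p) @[A --> (0:R)^'+] -->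
  \int[(lebesgue_measure \x lebesgue_measure)%E]_(p in [set p : R * R | 0 < p.2])
    (rho s0 p.1 p.2 * psi p).
Proof.
move=> bnd lim tpsi; have [M [B [M0 B0 supp psiB]]] := test_function_bounded tpsi.
have mD : measurable [set p : R * R | 0 < p.2].
  rewrite (_ : mkset _ = snd @^-1` `]0, +oo[).
    by rewrite -[X in measurable X]setTI; exact: measurable_snd.
  by apply/seteqP; split=> p /=; rewrite in_itv/= andbT.
have mpsi : measurable_fun setT psi.
  by apply: continuous_prod_measurable_fun; case: tpsi.
have mf (w : wave R) :
    measurable_fun [set p : R * R | 0 < p.2] (fun p => rho w p.1 p.2 * psi p).
  by apply: measurable_funTS; apply: measurable_funM => //; exact: measurable_rho.
pose E := `[- M, M]%classic `*` `[- M, M]%classic.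
apply: (cvg_Rintegral_at_right (lebesgue_measure \x lebesgue_measure)%E
  (f := fun A p => rho (s A) p.1 p.2 * psi p)
  (f0 := fun p => rho s0 p.1 p.2 * psi p) (g := fun p => C * B * \1_E p)) => //.
- by apply: nearW => A; exact: mf.
- exact: mf.
- apply: integrable_scaled_indic => //; first exact: measurableX.
  exact: lebesgue_square_lty.
- apply: filterS bnd => A bndA.
  apply: (@off_rays_ae _ beta (c1 A) (c2 A)) => x t h1 h2 /= t0.
  rewrite normrM -mulrA; apply: ler_pM => //; first exact: bndA.
  rewrite indicE; have [p0|p0] := eqVneq (psi (x, t)) 0.
    by rewrite p0 normr0 mulr_ge0.
  have [/= xM tM] := supp _ p0.
  by rewrite mem_set ?mulr1//; split; rewrite /= in_itv/= -ler_norml.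
- apply: (@off_rays_ae _ beta e1 e2) => x t h1 h2 /= t0.
  by apply: cvgMl; exact: lim.
Qed.

(** * Rays and the delta measures they carry *)

(** Speed and time vary together along any filter, so that this serves both for limits in [A] at a
    fixed time and for limits in time at a fixed speed. *)
Lemma cvg_ray {R : realType} {T : Type} {F : set_system T} {FF : Filter F}
    (beta : R) (v tau : T -> R) (v0 t0 : R) :
  v x @[x --> F] --> v0 -> tau x @[x --> F] --> t0 ->
  ray beta (v x) (tau x) @[x --> F] --> ray beta v0 t0.
Proof.
move=> cv ct; rewrite /ray expr2.
apply: cvgD; first exact: cvgM.
by under eq_fun do rewrite expr2; apply: cvgMr; exact: cvgM.
Qed.

(** With [v] and [w] constant this is continuity in time, hence measurability; with [tau] constant
    it is the pointwise limit in [A]. *)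
Lemma cvg_delta_integrand {R : realType} {T : Type} {F : set_system T}
    {FF : Filter F} (beta : R) (psi : R * R -> R) (v w tau : T -> R)
    (v0 w0 t0 : R) : continuous psi ->
  v x @[x --> F] --> v0 -> w x @[x --> F] --> w0 -> tau x @[x --> F] --> t0 ->
  w x * tau x * psi (ray beta (v x) (tau x), tau x) *
    Num.sqrt ((v x + beta * tau x) ^+ 2 + 1) @[x --> F] -->
  w0 * t0 * psi (ray beta v0 t0, t0) * Num.sqrt ((v0 + beta * t0) ^+ 2 + 1).
Proof.
move=> cpsi cv cw ct; apply: cvgM; first apply: cvgM; first exact: cvgM.
  apply: (@continuous_cvg _ _ _ _ _ _ psi); first exact: cpsi.
  exact: (cvg_pair (cvg_ray beta v tau v0 t0 cv ct) ct).
apply: (@continuous_cvg _ _ _ _ _ _ Num.sqrt); first exact: sqrt_continuous.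
rewrite expr2; under eq_fun do rewrite expr2.
have cb : v x + beta * tau x @[x --> F] --> v0 + beta * t0.
  by apply: cvgD => //; exact: cvgMr.
by apply: cvgD; [exact: cvgM|exact: cvg_cst].
Qed.

Lemma delta_integral_cvg {R : realType} (beta : R) (v w : R -> R) (v0 w0 : R)
    (psi : R * R -> R) :
  v A @[A --> (0:R)^'+] --> v0 -> w A @[A --> (0:R)^'+] --> w0 ->
  test_function psi ->
  \int[lebesgue_measure]_(t in `]0, +oo[) (w A * t * psi (ray beta (v A) t, t) *
    Num.sqrt ((v A + beta * t) ^+ 2 + 1)) @[A --> (0:R)^'+] -->
  \int[lebesgue_measure]_(t in `]0, +oo[) (w0 * t * psi (ray beta v0 t, t) *
    Num.sqrt ((v0 + beta * t) ^+ 2 + 1)).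
Proof.
move=> cv cw tpsi; have [cpsi _] := tpsi.
have [M [B [M0 B0 supp psiB]]] := test_function_bounded tpsi.
have mf (a b : R) : measurable_fun (`]0, +oo[%classic : set R) (fun t : R =>
    b * t * psi (ray beta a t, t) * Num.sqrt ((a + beta * t) ^+ 2 + 1)).
  apply: measurable_funTS; apply: continuous_measurable_fun => t.
  by apply: cvg_delta_integrand => //; exact: cvg_cst.
pose V := `|v0| + 1; pose W := `|w0| + 1.
have near_le (u : R -> R) l : u A @[A --> (0:R)^'+] --> l ->
    \forall A \near (0:R)^'+, `|u A| <= `|l| + 1.
  by move=> /cvg_norm h; apply: (cvgr_le _ h); rewrite ltrDl.
(* For small [A] and [|t| <= M], [|v A + beta t|] is at most [V + |beta| M], so [S] bounds the arc
   length factor. *)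
pose S := Num.sqrt ((V + `|beta| * M) ^+ 2 + 1).
apply: (cvg_Rintegral_at_right lebesgue_measure
  (f := fun A t => w A * t * psi (ray beta (v A) t, t) *
    Num.sqrt ((v A + beta * t) ^+ 2 + 1))
  (f0 := fun t => w0 * t * psi (ray beta v0 t, t) *
    Num.sqrt ((v0 + beta * t) ^+ 2 + 1))
  (g := fun t => (W * M * B * S) * \1_(`[- M, M]) t)).
- exact: measurable_itv.
- by apply: nearW => A; exact: mf.
- exact: mf.
- apply: integrable_scaled_indic; [exact: measurable_itv|exact: measurable_itv|].
  exact: lebesgue_segment_lty.
- apply: filterS2 (near_le _ _ cv) (near_le _ _ cw) => A vV wW; apply: aeW => t /=.
  rewrite in_itv/= andbT => t0.
  rewrite indicE; have [p0|p0] := eqVneq (psi (ray beta (v A) t, t)) 0.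
    by rewrite p0 mulr0 mul0r normr0 !mulr_ge0 ?sqrtr_ge0 ?addr_ge0.
  have [_ /= tM] := supp _ p0.
  rewrite mem_set ?mulr1; last by rewrite /= in_itv/= -ler_norml.
  rewrite !normrM; apply: ler_pM; rewrite ?mulr_ge0//.
    by apply: ler_pM; rewrite ?mulr_ge0//; exact: ler_pM.
  rewrite ger0_norm ?sqrtr_ge0//; apply: ler_wsqrtr; rewrite lerD2r.
  rewrite -real_normK ?num_real// ler_sqr ?nnegrE ?addr_ge0 ?mulr_ge0//.
  by rewrite (le_trans (ler_normD _ _))// lerD// normrM ler_wpM2l.
- apply: aeW => t _; apply: cvg_delta_integrand => //; exact: cvg_cst.
Qed.

Lemma is_derive_ray {R : realType} (beta c t : R) :
  is_derive t (1 : R) (ray beta c) (c + beta * t).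
Proof.
rewrite /ray; have -> : (fun t => c * t + 2^-1 * beta * t ^+ 2) =
  (c \*: (id : R -> R)) + (2^-1 * beta) \*: ((id : R -> R) ^+ 2).
  by apply/funext => z /=; rewrite /GRing.scale/=.
by apply: is_derive_eq; rewrite /GRing.scale /=; field.
Qed.

(** The curve is parametrized by time, so the arc length factor is the square root of [x'(t)^2 + 1],
    with [x'(t) = v + beta t]. *)
Lemma weighted_deltaE {R : realType} (beta v w : R) (d : delta_shock R)
    (psi : R * R -> R) :
  (forall t, 0 <= t -> position d t = ray beta v t) ->
  (forall t, 0 <= t -> weight d t = w * t) ->
  weighted_delta `]0, +oo[ (weight d) (position d) id psi =
  \int[lebesgue_measure]_(t in `]0, +oo[) (w * t * psi (ray beta v t, t) *
    Num.sqrt ((v + beta * t) ^+ 2 + 1)).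
Proof.
move=> pd wd; apply: eq_Rintegral => t; rewrite inE/= in_itv/= andbT => t0.
rewrite pd ?wd ?ltW//; congr (_ * Num.sqrt (_ ^+ 2 + _)); last first.
  by rewrite derive1E derive_id expr1n.
have dpos : is_derive t (1 : R) (position d) (v + beta * t).
  (* The position is known only for nonnegative times, but these contain a neighbourhood of every
     [t > 0]. *)
  apply: (near_eq_is_derive (f := ray beta v)); last exact: is_derive_ray.
  by have := lt_nbhsr t0; apply: filterS => z z0; rewrite pd// ltW.
by rewrite derive1E derive_val.
Qed.

(** * Characteristics as rays, and comparison of rays *)

(** The difference [Z] with the ray has zero derivative at positive times, so it is constant there,
    and it tends to 0 at the origin. *)
Lemma characteristic1_ray {R : realType} (alpha beta A r v : R) (X : R -> R)
    (t : R) : characteristic1 alpha beta A r v X -> 0 < t ->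
  X t = ray beta (lambda1 alpha A r v) t.
Proof.
move=> [X0 dX] t0; set c := lambda1 alpha A r v.
pose Z := X \- ray beta c.
have dZ (y : R) : 0 < y -> is_derive y (1 : R) Z 0.
  move=> y0; have dXy := dX y y0; have dry := is_derive_ray beta c y.
  by apply: is_derive_eq; rewrite subrr.
(* The mean value theorem on [[y, t]], a segment that avoids the origin. *)
have Zt : \forall y \near (0:R)^'+, Z y = Z t.
  near=> y.
  have y0 : 0 < y by near: y; exact: nbhs_right_gt.
  have yt : y <= t by near: y; exact: nbhs_right_le.
  have [||z _] := @MVT_segment _ Z (fun=> 0) y t yt.
  - by move=> z; rewrite in_itv/= => /andP[yz _]; apply: dZ; exact: lt_trans yz.
  - apply: derivable_within_continuous => z; rewrite in_itv/= => /andP[yz _].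
    by have [] := dZ z (lt_le_trans y0 yz).
  - by rewrite mul0r => /eqP; rewrite subr_eq0 => /eqP.
have Z0 : Z y @[y --> (0:R)^'+] --> 0 - ray beta c 0.
  apply: cvgB => //; apply: cvg_at_right_filter.
  by apply: cvg_ray; [exact: cvg_cst|exact: cvg_id].
rewrite /ray mulr0 expr0n mulr0 addr0 subrr in Z0.
apply/eqP; rewrite -subr_eq0; apply/eqP.
exact: (cvg_unique _ (cvg_near_cst (Z t) Zt) Z0).
Unshelve. all: by end_near. Qed.

(** At a positive time, positions can thus be replaced by speeds, which [ltr_ray] and [ler_ray_eq]
    compare. *)
Lemma exists_ray {R : realType} (beta x t : R) :
  0 < t -> exists c, x = ray beta c t.
Proof.
move=> t0; exists ((x - 2^-1 * beta * t ^+ 2) / t); rewrite /ray.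
by rewrite divfK ?gt_eqF// subrK.
Qed.

Lemma ltr_ray {R : realType} (beta c1 c2 t : R) :
  0 < t -> (ray beta c1 t < ray beta c2 t) = (c1 < c2).
Proof. by move=> t0; rewrite /ray ltrD2r ltr_pM2r. Qed.

Lemma ler_ray_eq {R : realType} (beta c1 c2 t : R) :
  0 < t -> (ray beta c1 t <= ray beta c2 t) = (c1 <= c2).
Proof. by move=> t0; rewrite /ray lerD2r ler_pM2r. Qed.

Lemma cvg_at_right0 {R : realType} : A @[A --> (0:R)^'+] --> (0:R).
Proof. by apply: cvg_at_right_filter; exact: cvg_id. Qed.

Lemma le_of_div_powR {R : realType} (A alpha r r' : R) :
  0 < A -> 0 < alpha -> 0 < r -> 0 < r' ->
  A / r' `^ alpha <= A / r `^ alpha -> r <= r'.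
Proof.
move=> A0 a0 r0 r'0; rewrite ler_pM2l// lef_pV2 ?posrE ?powR_gt0// => h.
rewrite leNgt; apply/negP => r'r; move: h; apply/negP; rewrite -ltNge.
by rewrite gt0_ltr_powR ?nnegrE ?ltW.
Qed.

(** * Limits away from the fronts *)

Section outer_states_limit.
Context {R : realType} (rhom um rhop up beta : R).
Variables (s : R -> wave R) (s0 : wave R).

(** The point lies strictly beyond the limiting front, hence beyond the moving front for small [A];
    density and velocity are then eventually constant in [A]. *)
Lemma outer_states_cvg (c1 c2 : R -> R) (e1 e2 x t : R) :
  (\forall A \near (0:R)^'+,
     outer_states (s A) rhom um rhop up beta (c1 A) (c2 A)) ->
  outer_states s0 rhom um rhop up beta e1 e2 ->
  c1 A @[A --> (0:R)^'+] --> e1 -> c2 A @[A --> (0:R)^'+] --> e2 ->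
  0 < t -> x < ray beta e1 t \/ ray beta e2 t < x ->
  rho (s A) x t @[A --> (0:R)^'+] --> rho s0 x t /\
  vel (s A) x t @[A --> (0:R)^'+] --> vel s0 x t.
Proof.
move=> outA out0 cv1 cv2 t0.
have cr (c : R -> R) e : c A @[A --> (0:R)^'+] --> e ->
    ray beta (c A) t @[A --> (0:R)^'+] --> ray beta e t.
  by move=> ce; apply: cvg_ray => //; exact: cvg_cst.
have [l0 r0] := out0 x t (ltW t0).
case=> [/[dup] xl /l0[-> ->]|/[dup] xr /r0[-> ->]].
- have lt : \forall A \near (0:R)^'+, x < ray beta (c1 A) t.
    exact: cvgr_gt (cr _ _ cv1) _ xl.
  by split; apply: cvg_near_cst; apply: filterS2 outA lt => A o xA;
    have [/(_ xA)[]] := o x t (ltW t0).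
- have lt : \forall A \near (0:R)^'+, ray beta (c2 A) t < x.
    exact: cvgr_lt (cr _ _ cv2) _ xr.
  by split; apply: cvg_near_cst; apply: filterS2 outA lt => A o xA;
    have [_ /(_ xA)[]] := o x t (ltW t0).
Qed.

(** Shared by the contact discontinuity and the delta shock: with a single front, the outer states
    cover everything off one ray, and the density is bounded by the larger of the two. *)
Lemma single_front_cvg (v : R -> R) (v0 : R) :
  0 < rhom -> 0 < rhop ->
  (\forall A \near (0:R)^'+,
     outer_states (s A) rhom um rhop up beta (v A) (v A)) ->
  outer_states s0 rhom um rhop up beta v0 v0 ->
  v A @[A --> (0:R)^'+] --> v0 ->
  [/\ forall x t, 0 < t -> x != ray beta v0 t ->
        rho (s A) x t @[A --> (0:R)^'+] --> rho s0 x t,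
      forall x t, 0 < t -> x != ray beta v0 t ->
        vel (s A) x t @[A --> (0:R)^'+] --> vel s0 x t &
      forall psi, test_function psi ->
  \int[(lebesgue_measure \x lebesgue_measure)%E]_(p in [set p : R * R | 0 < p.2])
    (rho (s A) p.1 p.2 * psi p) @[A --> (0:R)^'+] -->
  \int[(lebesgue_measure \x lebesgue_measure)%E]_(p in [set p : R * R | 0 < p.2])
    (rho s0 p.1 p.2 * psi p)].
Proof.
move=> rm0 rp0 outA out0 vv0.
have lim x t : 0 < t -> x != ray beta v0 t ->
    rho (s A) x t @[A --> (0:R)^'+] --> rho s0 x t /\
    vel (s A) x t @[A --> (0:R)^'+] --> vel s0 x t.
  by move=> t0 /lt_total/orP xv; exact: (outer_states_cvg v v v0 v0).
split=> [x t t0 xv|x t t0 xv|psi tpsi]; [exact: (lim x t t0 xv).1|exact: (lim x t t0 xv).2|].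
apply: (density_integral_cvg beta (Num.max rhom rhop) s s0 v v v0 v0) => //.
  apply: filterS outA => A o x t t0 /lt_total/orP xv _.
  by case: xv => [/(o x t (ltW t0)).1[-> _]|/(o x t (ltW t0)).2[-> _]];
    rewrite gtr0_norm// le_max lexx ?orbT.
by move=> x t t0 xv _; exact: (lim x t t0 xv).1.
Qed.

End outer_states_limit.

(** * From the rarefaction wave to the vacuum *)

Section vacuum.
Context {R : realType} (rhom um rhop up alpha beta : R).
Hypotheses (rhom_gt0 : 0 < rhom) (rhop_gt0 : 0 < rhop).
Hypotheses (alpha_gt0 : 0 < alpha) (alpha_lt1 : alpha < 1) (umup : um < up).

(** The first bound serves domination, the second makes the density vanish in the limit. In the fan
    both come from the formula for the characteristic speed, in the intermediate state from
    [A / rho_star^alpha = up - wminus]. *)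
Lemma rarefaction_density (A x t : R) (s : wave R) : 0 < A ->
  rarefaction_contact_wave s rhom um rhop up alpha beta A -> 0 < t ->
  ray beta (lambda1 alpha A rhom um) t <= x -> x < ray beta up t ->
  0 < rho s x t <= rhom /\
  forall c, um < c <= up -> ray beta c t <= x ->
    c - um <= A / rho s x t `^ alpha.
Proof.
move=> A0 [_ _ fan mid] t0 lx xu.
have [rs0 rsE] : 0 < rho_star rhom um up alpha A /\
    A / rho_star rhom um up alpha A `^ alpha = up - wminus rhom um alpha A.
  apply: rs_def => //; apply: lt_trans umup; exact: wm_lt.
have wE : A / rhom `^ alpha = um - wminus rhom um alpha A.
  by rewrite /wminus opprB addrCA subrr addr0.
have wu := wm_lt um alpha rhom_gt0 A0.
have [xr|rx] := leP x
  (ray beta (lambda1 alpha A (rho_star rhom um up alpha A) up) t).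
  have [r [v [X [r0 vw lam [chX Xt] st]]]] := fan x t t0 lx xr.
  have [+ _] := st t t0; rewrite Xt => ->.
  have lE : lambda1 alpha A r v =
      wminus rhom um alpha A + (1 - alpha) * (A / r `^ alpha).
    by rewrite /lambda1 -vw; ring.
  split.
    rewrite r0 /=; apply: (le_of_div_powR A alpha) => //.
    (* The speed is at least that of [(rhom, um)]; cancelling the factor [1 - alpha > 0] compares
       the two values of [A / r^alpha]. *)
    move: lam; rewrite lE /lambda1 -(mulrA A) (mulrC alpha) mulrA wE => lam.
    move: alpha_lt1; nra.
  move=> c /andP[uc cu]; rewrite -Xt (characteristic1_ray alpha beta A r v X t chX t0).
  rewrite ler_ray_eq// lE => cl.
  (* Since [wminus < um] and [1 - alpha < 1], the speed is at most [um + A / r^alpha]. *)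
  have : 0 <= A / r `^ alpha by rewrite divr_ge0 ?powR_ge0 ?ltW.
  by move: alpha_gt0; nra.
have [-> _] := mid x t (ltW t0) rx xu.
split.
  rewrite rs0 /=; apply: (le_of_div_powR A alpha) => //.
  by rewrite rsE wE lerD2r ltW.
by move=> c /andP[uc cu] _; rewrite rsE; lra.
Qed.

Lemma rarefaction_tends_to (s : R -> wave R) (s0 : wave R) :
  (forall A, 0 < A ->
     rarefaction_contact_wave (s A) rhom um rhop up alpha beta A) ->
  vacuum_wave s0 rhom um rhop up beta ->
  tends_to (pressureless_fronts rhom um rhop up beta) s s0.
Proof.
move=> rcA [d0 out0 vac].
have pos : \forall A \near (0:R)^'+, 0 < A by exact: nbhs_right_gt.
have outA : \forall A \near (0:R)^'+,
    outer_states (s A) rhom um rhop up beta (lambda1 alpha A rhom um) up.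
  by apply: filterS pos => A /rcA[].
have c1 : lambda1 alpha A rhom um @[A --> (0:R)^'+] --> um.
  suff : lambda1 alpha A rhom um @[A --> (0:R)^'+] --> um - 0 * (alpha / rhom `^ alpha).
    by rewrite mul0r subr0.
  apply: cvgB; first exact: cvg_cst.
  by under eq_fun do rewrite -mulrA; apply: cvgMl; exact: cvg_at_right0.
have frontsE x t : ~ pressureless_fronts rhom um rhop up beta (x, t) ->
    x != ray beta um t /\ x != ray beta up t.
  rewrite /pressureless_fronts /= ltNge ltW//= => /not_orP[xm xp].
  by split; exact/eqP.
have lim x t : 0 < t -> x != ray beta um t -> x != ray beta up t ->
    rho (s A) x t @[A --> (0:R)^'+] --> rho s0 x t /\
    (rho s0 x t != 0 -> vel (s A) x t @[A --> (0:R)^'+] --> vel s0 x t).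
  move=> t0 xm xp.
  have [lo|ml] := ltP x (ray beta um t).
    have [] := outer_states_cvg rhom um rhop up beta s s0 _ _ um up x t outA out0
      c1 (cvg_cst _) t0 (or_introl lo).
    by [].
  have [hi|pl] := ltP (ray beta up t) x.
    have [] := outer_states_cvg rhom um rhop up beta s s0 _ _ um up x t outA out0
      c1 (cvg_cst _) t0 (or_intror hi).
    by [].
  have mx : ray beta um t < x by rewrite lt_neqAle eq_sym xm.
  have xu : x < ray beta up t by rewrite lt_neqAle xp.
  (* Between the limiting fronts the limit density is 0, so the velocity clause is void. *)
  rewrite (vac x t (ltW t0) mx xu); split; last by rewrite eqxx.
  have [c xE] := exists_ray beta x t t0.
  have uc : um < c by rewrite -(ltr_ray beta _ _ _ t0) -xE.
  have cu : c < up by rewrite -(ltr_ray beta _ _ _ t0) -xE.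
  apply/cvgr0Pnorm_lt => e e0.
  (* A density at least [e] would give [A / rho^alpha <= A / e^alpha], which this threshold puts
     below [c - um], against [rarefaction_density]. *)
  have small : \forall A \near (0:R)^'+, A < (c - um) * e `^ alpha.
    by apply: nbhs_right_lt; rewrite mulr_gt0 ?powR_gt0 ?subr_gt0.
  apply: filterS2 pos small => A A0 Ae.
  (* [lambda1] at [(rhom, um)] is at most [um < c], so the point is never to the left of the fan. *)
  have lx : ray beta (lambda1 alpha A rhom um) t <= x.
    rewrite xE ler_ray_eq// /lambda1 lerBlDr ltW// (lt_le_trans uc)// lerDl.
    by rewrite divr_ge0 ?powR_ge0// mulr_ge0 // ltW.
  have [/andP[r0 _] bound] := rarefaction_density A x t (s A) A0 (rcA A A0) t0 lx xu.
  have h : c - um <= A / rho (s A) x t `^ alpha.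
    by apply: bound; rewrite ?uc ?(ltW cu) -?xE.
  rewrite gtr0_norm// ltNge; apply/negP => er.
  have : A / rho (s A) x t `^ alpha < c - um.
    rewrite ltr_pdivrMr ?powR_gt0//; apply: (lt_le_trans Ae).
    rewrite ler_pM2l ?subr_gt0//; apply: ge0_ler_powR; rewrite ?nnegrE//; exact: ltW.
  by rewrite ltNge h.
have dA : \forall A \near (0:R)^'+, delta (s A) = None.
  by apply: filterS pos => A /rcA[].
split.
- by move=> x t t0 /frontsE[xm xp]; exact: (lim x t t0 xm xp).1.
- by move=> x t t0 /frontsE[xm xp]; exact: (lim x t t0 xm xp).2.
- move=> psi tpsi; rewrite /density_pairing d0 addr0.
  apply: (cvg_trans (near_eq_cvg (f := fun A => 
    \int[(lebesgue_measure \x lebesgue_measure)%E]_(p in [set p : R * R | 0 < p.2])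
    (rho (s A) p.1 p.2 * psi p)) _)).
    by apply: filterS dA => A ->; rewrite addr0.
  apply: (density_integral_cvg beta (Num.max rhom rhop) s s0
     (fun A => lambda1 alpha A rhom um) (fun=> up) um up) => //.
    apply: filterS pos => A A0 x t t0 xm xp.
    have [_ o _ _] := rcA A A0; have [ol or] := o x t (ltW t0).
    have [xl|lx] := ltP x (ray beta (lambda1 alpha A rhom um) t).
      by have [-> _] := ol xl; rewrite gtr0_norm// le_max lexx.
    have [ux|xu] := ltP (ray beta up t) x.
      by have [-> _] := or ux; rewrite gtr0_norm// le_max lexx orbT.
    have {}xu : x < ray beta up t by rewrite lt_neqAle xp.
    have [/andP[r0 rm] _] := rarefaction_density A x t (s A) A0 (rcA A A0) t0 lx xu.
    by rewrite gtr0_norm// le_max rm.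
  by move=> x t t0 xm xp; exact: (lim x t t0 xm xp).1.
- by rewrite d0.
Qed.

End vacuum.

(** * The contact discontinuity *)

(** For every [A > 0] the solutions agree off the common front: this is [single_front_cvg] at a
    constant speed. *)
Lemma contact_tends_to {R : realType} (rhom u rhop beta : R)
    (s : R -> wave R) (s0 : wave R) :
  0 < rhom -> 0 < rhop ->
  (forall A, 0 < A -> contact_wave (s A) rhom u rhop u beta) ->
  contact_wave s0 rhom u rhop u beta ->
  tends_to (pressureless_fronts rhom u rhop u beta) s s0.
Proof.
move=> rm0 rp0 cA [d0 out0].
have pos : \forall A \near (0:R)^'+, 0 < A by exact: nbhs_right_gt.
have outA : \forall A \near (0:R)^'+,
    outer_states (s A) rhom u rhop u beta u u.
  by apply: filterS pos => A /cA[].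
have [lim_rho lim_vel lim_int] := single_front_cvg rhom u rhop u beta s s0
  (fun=> u) u rm0 rp0 outA out0 (cvg_cst _).
have frontsE x t : ~ pressureless_fronts rhom u rhop u beta (x, t) ->
    x != ray beta u t.
  by rewrite /pressureless_fronts /= ltxx => /not_orP[xm _]; exact/eqP.
have dA : \forall A \near (0:R)^'+, delta (s A) = None.
  by apply: filterS pos => A /cA[].
split.
- by move=> x t t0 /frontsE; exact: lim_rho.
- by move=> x t t0 /frontsE xu _; exact: lim_vel.
- move=> psi /lim_int; rewrite /density_pairing d0 addr0.
  apply: cvg_trans; apply: near_eq_cvg.
  by apply: filterS dA => A ->; rewrite addr0.
- by rewrite d0.
Qed.

(** * The delta shock wave *)

(** Splits the pairing into its absolutely continuous and singular parts, an equality available only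
    for small [A]. *)
Lemma near_eq_cvgD {R : realType} {F : set_system R} {FF : Filter F}
    (f g h : R -> R) (a b : R) :
  (\forall x \near F, f x = g x + h x) ->
  g x @[x --> F] --> a -> h x @[x --> F] --> b -> f x @[x --> F] --> a + b.
Proof.
move=> fgh ga hb.
have gh : g x + h x @[x --> F] --> a + b by exact: cvgD.
apply: cvg_trans gh; apply: near_eq_cvg.
by apply: filterS fgh => x ->.
Qed.

Section delta_limit.
Context {R : realType} (rhom um rhop up alpha beta : R).
Hypotheses (rhom_gt0 : 0 < rhom) (rhop_gt0 : 0 < rhop) (upum : up < um).

(** [A] enters only through quotients by constants, inside polynomials and a square root that is
    continuous on the whole line. *)
Lemma cvg_w0 :
  w0 rhom um rhop up alpha A @[A --> (0:R)^'+] --> w0 rhom um rhop up alpha 0.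
Proof.
rewrite /w0; case: ifP => _; first exact: cvg_cst.
have cdiv (k : R) : A / k @[A --> (0:R)^'+] --> 0 / k.
  by apply: cvgMl; exact: cvg_at_right0.
apply: cvgB; last by apply: cvgMr; apply: cvgB.
apply: (@continuous_cvg _ _ _ _ _ _ Num.sqrt); first exact: sqrt_continuous.
apply: cvgD.
  by apply: cvgMr; apply: cvgB; [exact: cvg_cst|apply: cvgB].
apply: cvgMr; rewrite expr2; under eq_fun do rewrite expr2.
by apply: cvgM; apply: cvgB.
Qed.

Lemma cvg_v_delta :
  v_delta rhom um rhop up alpha A @[A --> (0:R)^'+] -->
  v_delta rhom um rhop up alpha 0.
Proof.
rewrite /v_delta; case: ifP => _.
  apply: cvgMr; apply: cvgB; first exact: cvg_cst.
  by apply: cvgMl; exact: cvg_at_right0.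
by apply: cvgMl; apply: cvgD; [exact: cvg_cst|exact: cvg_w0].
Qed.

(** At [A = 0] the radicand is [rhop * rhom * (up - um)^2], and [up < um] fixes the sign of its
    root. *)
Lemma w0_at0 : w0 rhom um rhop up alpha 0 = Num.sqrt (rhom * rhop) * (um - up).
Proof.
rewrite /w0; case: eqP => [->|_].
  by rewrite -expr2 sqrtr_sqr gtr0_norm// mulrBr.
rewrite !mul0r !subr0 expr0n !mulr0 addr0 subr0.
rewrite -mulrA -expr2 -sqrrN opprB sqrtrM ?mulr_ge0 ?ltW// sqrtr_sqr.
by rewrite gtr0_norm ?subr_gt0// (mulrC rhop).
Qed.

(** Let [a] and [b] be the square roots of [rhom] and [rhop]. The numerator factors as
    [(b - a) (b up + a um)] and the denominator as [(b - a) (b + a)]. For equal densities both sides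
    are the mean velocity. *)
Lemma v_delta_at0 : v_delta rhom um rhop up alpha 0 = sigma0 rhom um rhop up.
Proof.
rewrite /v_delta w0_at0 /sigma0; case: eqP => [->|/eqP ne].
  rewrite mul0r subr0; field.
  by rewrite -mulr2n mulrn_eq0/= gt_eqF ?sqrtr_gt0.
rewrite sqrtrM ?ltW//.
have rm : rhom = Num.sqrt rhom ^+ 2 by rewrite sqr_sqrtr ?ltW.
have rp : rhop = Num.sqrt rhop ^+ 2 by rewrite sqr_sqrtr ?ltW.
have : 0 < Num.sqrt rhom by rewrite sqrtr_gt0.
have : 0 < Num.sqrt rhop by rewrite sqrtr_gt0.
move: (Num.sqrt rhom) (Num.sqrt rhop) rm rp ne => a b -> -> ne b0 a0.
have ab : a + b != 0 by rewrite gt_eqF ?addr_gt0.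
have ba : b ^+ 2 - a ^+ 2 != 0 by rewrite subr_eq0.
by apply/eqP; rewrite eqr_div//; apply/eqP; ring.
Qed.

Lemma delta_shock_tends_to (s : R -> wave R) (s0 : wave R) :
  (\forall A \near (0:R)^'+, delta_shock_wave (s A) rhom um rhop up beta
     (v_delta rhom um rhop up alpha A) (w0 rhom um rhop up alpha A)) ->
  delta_shock_wave s0 rhom um rhop up beta (sigma0 rhom um rhop up)
    (Num.sqrt (rhom * rhop) * (um - up)) ->
  tends_to (pressureless_fronts rhom um rhop up beta) s s0.
Proof.
move=> shockA [out0 [d0 s0d d0P]].
have cv := cvg_v_delta; rewrite v_delta_at0 in cv.
have cw := cvg_w0; rewrite w0_at0 in cw.
(* The default [d0] is irrelevant to the limit: for small [A] there is a delta part. *)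
pose d A := if delta (s A) is Some d1 then d1 else d0.
have dA : \forall A \near (0:R)^'+, delta (s A) = Some (d A) /\
    forall t, 0 <= t ->
      [/\ position (d A) t = ray beta (v_delta rhom um rhop up alpha A) t,
          weight (d A) t = w0 rhom um rhop up alpha A * t &
          delta_speed (d A) t = v_delta rhom um rhop up alpha A + beta * t].
  apply: filterS shockA => A [_ [d1 sd d1P]]; rewrite /d sd; split=> // t t0.
  by have [] := d1P t t0.
have outA : \forall A \near (0:R)^'+, outer_states (s A) rhom um rhop up beta
    (v_delta rhom um rhop up alpha A) (v_delta rhom um rhop up alpha A).
  by apply: filterS shockA => A [].
have [lim_rho lim_vel lim_int] := single_front_cvg rhom um rhop up beta s s0
  _ _ rhom_gt0 rhop_gt0 outA out0 cv.
have frontsE x t : ~ pressureless_fronts rhom um rhop up beta (x, t) ->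
    x != ray beta (sigma0 rhom um rhop up) t.
  by rewrite /pressureless_fronts /= upum => /eqP.
split.
- by move=> x t t0 /frontsE; exact: lim_rho.
- by move=> x t t0 /frontsE xu _; exact: lim_vel.
- move=> psi tpsi.
  rewrite /density_pairing s0d (weighted_deltaE beta (sigma0 rhom um rhop up)
    (Num.sqrt (rhom * rhop) * (um - up))); last 2 first.
  + by move=> t /d0P[].
  + by move=> t /d0P[].
  apply: near_eq_cvgD (lim_int _ tpsi)
    (delta_integral_cvg beta _ _ _ _ psi cv cw tpsi).
  apply: filterS dA => A [-> dAP].
  rewrite (weighted_deltaE beta (v_delta rhom um rhop up alpha A)
    (w0 rhom um rhop up alpha A))// => t /dAP[].
  + by [].
  + by [].
- rewrite s0d; exists d; split; first by apply: filterS dA => A [].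
  move=> t t0; have [-> -> -> _] := d0P t (ltW t0).
  split.
  + apply: (@cvg_trans _ (ray beta (v_delta rhom um rhop up alpha A) t @[A --> (0:R)^'+])).
      by apply: near_eq_cvg; apply: filterS dA => A [_ /(_ t (ltW t0))[->]].
    by apply: cvg_ray => //; exact: cvg_cst.
  + apply: (@cvg_trans _ ((w0 rhom um rhop up alpha A * t) @[A --> (0:R)^'+])).
      by apply: near_eq_cvg; apply: filterS dA => A [_ /(_ t (ltW t0))[_ ->]].
    exact: cvgMl.
  + apply: (@cvg_trans _ ((v_delta rhom um rhop up alpha A + beta * t) @[A --> (0:R)^'+])).
      by apply: near_eq_cvg; apply: filterS dA => A [_ /(_ t (ltW t0))[_ _ ->]].
    by apply: cvgD => //; exact: cvg_cst.
Qed.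

End delta_limit.

Theorem theorem5p3 (R : realType) (rhom um rhop up alpha beta : R)
    (rhom_gt0 : 0 < rhom) (rhop_gt0 : 0 < rhop)
    (alpha_gt0 : 0 < alpha) (alpha_lt1 : alpha < 1)
    (s : R -> wave R) (s0 : wave R)
    (approx_s : forall A : R, 0 < A ->
       approx_solution rhom um rhop up alpha beta A (s A))
    (pressureless_s0 : pressureless_solution rhom um rhop up beta s0) :
  tends_to (pressureless_fronts rhom um rhop up beta) s s0.
Proof.
have [vac0 contact0 shock0] := pressureless_s0.
have [umup|upum|umup] := ltgtP um up.
- apply: (rarefaction_tends_to rhom um rhop up alpha beta) => //; last exact: vac0.
  by move=> A /approx_s[rcA _ _ _]; exact: rcA.
- apply: (delta_shock_tends_to rhom um rhop up alpha beta) => //; last exact: shock0.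
  (* This threshold means [up < wminus]: for small [A] the shock followed by a contact discontinuity
     is excluded and only the delta shock remains. *)
  have small : \forall A \near (0:R)^'+, A < (um - up) * rhom `^ alpha.
    by apply: nbhs_right_lt; rewrite mulr_gt0 ?powR_gt0 ?subr_gt0.
  apply: filterS2 (nbhs_right_gt _) small => A /approx_s[_ _ _ shockA] Asmall.
  apply: shockA; rewrite /wminus lerBrDr addrC -lerBrDr.
  by rewrite ler_pdivrMr ?powR_gt0// ltW.
- rewrite -umup; apply: contact_tends_to => //.
    by move=> A /approx_s[_ + _ _]; rewrite -umup; exact.
  by move: contact0; rewrite -umup; exact.
Qed.
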